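(* Let $H_1,H_2$ be finite-dimensional real Hilbert spaces, let $C\subset H_1$ and $Q\subset H_2$ be nonempty closed convex subsets, and let $A:H_1\to H_2$ be a bounded linear operator. Let $f:C\times C\to\mathbb{R}$ and $g:Q\times Q\to\mathbb{R}$ be hemicontinuous bifunctions satisfying the following conditions: (i) $f$ and $g$ are both monotone; (ii) $f$ and $g$ are both convex in the second variable; (iii) $f$ and $g$ are both lower semi-continuous in the second variable; (iv) $f(p,p)\ge 0$ and $g(q,q)\ge 0$ for every $(p,q)\in C\times Q$. Then the split equilibrium problem (SEP) determined by $(C,Q,A,f,g)$ is well-posed if and only if it has a unique solution.
   Context: The product $H_1\times H_2$ carries its usual Hilbert space norm. Split equilibrium problem (SEP): find $x^*\in C$ such that $f(x^*,p)\ge 0$ for all $p\in C$, and such that $y^*=Ax^*$ belongs to $Q$ and satisfies $g(y^*,q)\ge 0$ for all $q\in Q$. A solution is identified with the pair $(x^*,y^* )=(x^*,Ax^* )$, so the solution set is $$S=\{(x,y)\in C\times Q:\ y=Ax,\ f(x,p)\ge 0\ \forall p\in C,\ g(y,q)\ge 0\ \forall q\in Q\}.$$ A sequence $\{(x_n,y_n)\}$ in $H_1\times H_2$ is an approximating sequence for the SEP if there exist real numbers $\epsilon_n>0$ with $\epsilon_n\to 0$ such that, for all $n$: $x_n\in C$, $y_n\in Q$, $\|y_n-Ax_n\|\le\epsilon_n$, $f(x_n,p)\ge-\epsilon_n$ for all $p\in C$, and $g(y_n,q)\ge-\epsilon_n$ for all $q\in Q$. The SEP is well-posed if $S$ is a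 singleton and every approximating sequence for the SEP converges to the unique element of $S$. For a nonempty convex subset $K$ of a real Hilbert space, a bifunction $h:K\times K\to\mathbb{R}$ is: monotone if $h(x,y)+h(y,x)\le 0$ for all $x,y\in K$; hemicontinuous if $\limsup_{t\to 0^+}h(x+t(y-x),y)\le h(x,y)$ for all $x,y\in K$; convex in the second variable if $h(x,\cdot)$ is convex on $K$ for every $x\in K$; lower semi-continuous in the second variable if for every $x\in K$, every $y\in K$ and every sequence $\{y_n\}$ in $K$ with $y_n\to y$, $h(x,y)\le\liminf_{n\to\infty}h(x,y_n)$. *)

(* Defs.v *)
From HB Require Import structures.
From mathcomp Require Import all_boot all_order all_algebra.
From mathcomp Require Import all_classical all_reals all_analysis.

Set Implicit Arguments.
Unset Strict Implicit.
Unset Printing Implicit Defensive.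

Import Order.TTheory GRing.Theory Num.Theory.
Import numFieldNormedType.Exports.

Local Open Scope classical_set_scope.
Local Open Scope ring_scope.

(* Completeness is carried by [completeNormedModType]. *)
Definition is_hilbert (R : realType) (H : completeNormedModType R) : Prop :=
  exists ip : {dot H for idfun}, forall x : H, `|x| = Num.sqrt (ip x x).

Definition finite_dimensional (R : realType) (H : lmodType R) : Prop :=
  exists (n : nat) (b : 'I_n -> H),
    forall x : H, exists c : 'I_n -> R, x = \sum_(i < n) c i *: b i.

Definition bounded_operator (R : realType) (H1 H2 : normedModType R)
    (A : H1 -> H2) : Prop :=
  exists M : R, forall x : H1, `|A x| <= M * `|x|.

(* The library norm on a product type is the max norm, hence this definition. *)
Definition hilbert_prod_norm (R : realType) (H1 H2 : normedModType R)
    (z : H1 * H2) : R :=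
  Num.sqrt (`|z.1| ^+ 2 + `|z.2| ^+ 2).

Definition hilbert_prod_cvg (R : realType) (H1 H2 : normedModType R)
    (z_ : nat -> H1 * H2) (z : H1 * H2) : Prop :=
  (fun n => hilbert_prod_norm (z_ n - z)) @ \oo --> (0 : R).

(* A bifunction on K * K is a total function [h : H -> H -> R] of which only
   the values at points of K are constrained. *)
Section Bifunctions.
Context (R : realType) (H : normedModType R).
Implicit Types (K : set H) (h : H -> H -> R).

Definition monotone_bifun K h : Prop :=
  forall x y, K x -> K y -> h x y + h y x <= 0.

(* For K convex and 0 < t <= 1 the point x + t (y - x) lies in K, so the
   limsup at 0^+ does not see the values of h outside K. *)
Definition hemicontinuous_bifun K h : Prop :=
  forall x y, K x -> K y ->
    (limf_esup (fun t : R => (h (x + t *: (y - x)) y)%:E) 0^'+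
       <= (h x y)%:E)%E.

Definition convex_snd K h : Prop :=
  forall x, K x -> convex_function K (h x).

Definition lsc_snd K h : Prop :=
  forall x, K x -> forall y, K y -> forall y_ : nat -> H,
    (forall n, K (y_ n)) -> y_ @ \oo --> y ->
    ((h x y)%:E <= limn_einf (fun n => (h x (y_ n))%:E))%E.

End Bifunctions.

Section SplitEquilibrium.
Context (R : realType) (H1 H2 : normedModType R).
Variables (C : set H1) (Q : set H2) (A : H1 -> H2).
Variables (f : H1 -> H1 -> R) (g : H2 -> H2 -> R).

Definition SEP_solutions : set (H1 * H2) :=
  [set z | [/\ C z.1, Q z.2, z.2 = A z.1,
               forall p, C p -> 0 <= f z.1 p
             & forall q, Q q -> 0 <= g z.2 q]].

Definition SEP_approximating (z_ : nat -> H1 * H2) : Prop :=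
  exists eps : nat -> R,
    [/\ forall n, 0 < eps n,
        eps @ \oo --> (0 : R)
      & forall n,
          [/\ C (z_ n).1, Q (z_ n).2,
              `|(z_ n).2 - A (z_ n).1| <= eps n,
              forall p, C p -> - eps n <= f (z_ n).1 p
            & forall q, Q q -> - eps n <= g (z_ n).2 q]].

Definition SEP_well_posed : Prop :=
  exists z, SEP_solutions = [set z] /\
    forall z_, SEP_approximating z_ -> hilbert_prod_cvg z_ z.

End SplitEquilibrium.

(* Main.v *)
Require Import Defs.
From HB Require Import structures.
From mathcomp Require Import all_boot all_order all_algebra.
From mathcomp Require Import all_classical all_reals all_analysis.
From mathcomp Require Import lra.

Set Implicit Arguments.
Unset Strict Implicit.
Unset Printing Implicit Defensive.

Import Order.TTheory GRing.Theory Num.Theory.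
Import numFieldNormedType.Exports.

Local Open Scope classical_set_scope.
Local Open Scope ring_scope.

(** Only one implication has content: uniqueness must force every
approximating sequence to converge.

For e >= 0 let N e be the set of pairs (x, y) in C * Q with
|y - A x| <= e, f p x <= e for all p in C and g q y <= e for all q in Q
([split_minty_set]).  The unknown sits in the second argument of the
bifunctions, where they are convex and lower semicontinuous; this gives
the N e the geometry that the sets defined by f x p >= - e lack.

- By monotonicity, an e-approximate solution lies in N e
  ([monotone_split_minty_set]); in particular the solution z lies in N 0.
- By lower semicontinuity N e is closed ([split_minty_set_closed]), and by
  convexity the segment from a point of N 0 to a point of N e stays in N e
  ([split_minty_set_segment]).
- Minty's argument, which is where hemicontinuity enters, shows that a point
  of N 0 is a solution ([minty], [split_minty]).  Hence the intersection of
  all N e with e > 0, which is N 0, is reduced to z.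

It remains to see that the N e shrink to z ([split_minty_set_shrink]).  Fix
d > 0.  In finite dimension the sphere of center z and radius d is compact.
If every N e met it, the decreasing closed sets N e would have a common point
on it, that is, a solution other than z.  So some N e misses the sphere, and
then, as every point of N e is joined to z inside N e, it lies in the open
ball of radius d.  No bound on N e is needed beforehand: unbounded
approximating sequences are pulled back to the sphere along segments.

Compactness of balls in a space given by a finite spanning family is obtained
by extracting a basis and showing that the norm dominates the coordinates
([lincomb_norm_lower]). *)

(** * Convexity and Minty sets of a bifunction *)

Section MintySets.
Context (R : realType) (H : normedModType R).
Implicit Types (K : set H) (h : H -> H -> R).

Lemma convex_set_segment K x y (t : R) : convex_set K -> K x -> K y ->
  0 <= t <= 1 -> K (x + t *: (y - x)).
Proof.
move=> Kcvx Kx Ky /andP[t0 t1].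
have := Kcvx y x (Itv01 t0 t1) (mem_set Ky) (mem_set Kx).
rewrite inE; congr (K _).
rewrite [LHS](_ : _ = t *: y + (1 - t) *: x)//.
by rewrite scalerBl scale1r scalerBr addrCA.
Qed.

Lemma convex_snd_segment K h p x y (t : R) :
  convex_snd K h -> K p -> K x -> K y -> 0 <= t <= 1 ->
  h p (x + t *: (y - x)) <= (1 - t) * h p x + t * h p y.
Proof.
move=> hcvx Kp Kx Ky /andP[t0 t1].
have : h p (t *: y + (1 - t) *: x) <= t * h p y + (1 - t) * h p x.
  exact: (hcvx p Kp (Itv01 t0 t1) y x (mem_set Ky) (mem_set Kx)).
by rewrite scalerBl scale1r scalerBr addrCA [leRHS]addrC.
Qed.

(** The approximate solutions of the dual (Minty) form of the equilibrium
problem. *)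
Definition minty_set K h (e : R) : set H :=
  [set x | K x /\ forall p, K p -> h p x <= e].

Lemma minty_set_le K h e e' : e <= e' -> minty_set K h e `<=` minty_set K h e'.
Proof. by move=> ee' x [Kx hx]; split=> // p /hx /le_trans; exact. Qed.

Lemma minty_set_segment K h e x y (t : R) : convex_set K -> convex_snd K h ->
  minty_set K h 0 x -> minty_set K h e y -> 0 <= e -> 0 <= t <= 1 ->
  minty_set K h e (x + t *: (y - x)).
Proof.
move=> Kcvx hcvx [Kx hx] [Ky hy] e0 t01; split.
  exact: convex_set_segment.
move=> p Kp; apply: le_trans (convex_snd_segment hcvx Kp Kx Ky t01) _.
move: (hx _ Kp) (hy _ Kp) t01 => px py /andP[t0 t1]; nra.
Qed.

Lemma closure_sequence (D : set H) x : closure D x ->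
  exists2 u : nat -> H, (forall n, D (u n)) & u @ \oo --> x.
Proof.
move=> Dx.
have /choice[u uP] (n : nat) : exists y, D y /\ ball x (harmonic n) y.
  have [|y Dy] := Dx (ball x (@harmonic R n)); last by exists y.
  by apply: nbhsx_ballx; rewrite invr_gt0.
exists u => [n|]; first by have [] := uP n.
apply/cvgrPdist_le => e e0; near=> n.
have [_] := uP n; rewrite -ball_normE /= => /ltW/le_trans; apply.
near: n; have := @cvg_harmonic R => /cvgrPdist_le/(_ _ e0).
apply: filterS => n /=.
by rewrite sub0r normrN ger0_norm ?invr_ge0.
Unshelve. all: by end_near. Qed.

(** Lower semicontinuity is stated with sequences, hence the detour through
[closure_sequence]. *)
Lemma minty_set_closed K h e :
  closed K -> lsc_snd K h -> closed (minty_set K h e).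
Proof.
move=> Kcl hlsc x /closure_sequence[u uD ux].
have Ku n : K (u n) by have [] := uD n.
have Kx : K x by apply: (closed_cvg K) ux => //; exact: nearW.
split=> // p Kp; rewrite -lee_fin.
apply: le_trans (hlsc _ Kp _ Kx u Ku ux) _.
apply: le_trans (limn_einf_sup _) _.
apply: (@le_trans _ _ (ereal_sup ((fun n => (h p (u n))%:E) @` setT))).
  by apply: ereal_inf_lbound; exists setT => //; exact: filterT.
apply: ge_ereal_sup => _ [n _ <-]; rewrite lee_fin.
by have [_] := uD n; exact.
Qed.

(** Minty's argument: for z = x + t (p - x) with 0 < t <= 1, convexity gives
0 <= h z z <= (1 - t) h z x + t h z p, and h z x <= 0, so h z p >= 0; now let t
tend to 0. *)
Lemma minty K h x :
  convex_set K -> convex_snd K h -> hemicontinuous_bifun K h ->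
  (forall p, K p -> 0 <= h p p) -> minty_set K h 0 x ->
  forall p, K p -> 0 <= h x p.
Proof.
move=> Kcvx hcvx hhemi hdiag [Kx hx] p Kp.
rewrite -lee_fin; apply: le_trans (hhemi _ _ Kx Kp).
apply: le_ereal_inf_tmp => _ [V V0 <-].
(* Every V in the filter contains a t in ]0, 1], and such a t bounds the
   supremum over V from below by a nonnegative value. *)
have /filter_ex[t [Vt /= t01]] : \forall t \near 0^'+, V t /\ 0 < t <= 1.
  near=> t; split; first by near: t; exact: V0.
  apply/andP; split; near: t; first exact: nbhs_right_gt.
  exact: nbhs_right_le.
apply: (@le_trans _ _ (h (x + t *: (p - x)) p)%:E); last first.
  by apply: ereal_sup_ubound; exists t.
have /andP[t0 t1] := t01.
have t01' : 0 <= t <= 1 by rewrite (ltW t0).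
have Kz := convex_set_segment Kcvx Kx Kp t01'.
have := convex_snd_segment hcvx Kz Kx Kp t01'.
move: (hdiag _ Kz) (hx _ Kz).
rewrite lee_fin.
set a := h _ _; set b := h _ x; set c := h _ p; nra.
Unshelve. all: by end_near. Qed.

End MintySets.

(** * Compactness of balls in finite dimension *)

Section FiniteDimension.
Context (R : realType) (H : normedModType R).

Definition lincomb n (b : 'I_n -> H) (c : 'rV[R]_n) : H :=
  \sum_(i < n) c ord0 i *: b i.

(** A spanning family of minimal length is free: a nontrivial relation
would allow one of its vectors to be dropped. *)
Lemma free_spanning_family : finite_dimensional H ->
  exists n (b : 'I_n -> H), (forall x, exists c, x = lincomb b c) /\
    forall c, lincomb b c = 0 -> c = 0.
Proof.
move=> [n0 [b0 b0_span]].
pose P n := `[< exists b : 'I_n -> H, forall x, exists c, x = lincomb b c >].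
have exP : exists n, P n.
  exists n0; apply/asboolP; exists b0 => x; have [c ->] := b0_span x.
  by exists (\row_i c i); apply: eq_bigr => i _; rewrite mxE.
case: (ex_minnP exP) => n /asboolP[b b_span] n_min.
exists n, b; split=> // c c0; apply/rowP => k; rewrite mxE.
apply/eqP/negPn/negP => ck.
case: n => [|n] in b b_span n_min c c0 k ck *; first by case: k {ck}.
suff : (n.+1 <= n)%N by rewrite ltnn.
apply: n_min; apply/asboolP; exists (b \o lift k) => x.
have [d ->] := b_span x.
(* Subtracting a multiple of the relation c cancels the coefficient of b k. *)
pose a := d ord0 k / c ord0 k.
exists (\row_j (d ord0 (lift k j) - a * c ord0 (lift k j))).
have -> : lincomb b d = lincomb b d - a *: lincomb b c.
  by rewrite c0 scaler0 subr0.
rewrite /lincomb scaler_sumr -sumrB (bigD1_ord k)//= scalerA divfK//.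
rewrite subrr add0r.
by apply: eq_bigr => j _; rewrite mxE scalerA scalerBl.
Qed.

Lemma lincomb_continuous n (b : 'I_n -> H) : continuous (lincomb b).
Proof.
apply: continuous_big => [|i _ c]; first exact: add_continuous.
apply: (@cvgZr_tmp _ _ _ (nbhs c) _ (fun d : 'rV[R]_n => d ord0 i)).
exact: coord_continuous.
Qed.

Lemma lincombZ n (b : 'I_n -> H) a c : lincomb b (a *: c) = a *: lincomb b c.
Proof.
by rewrite /lincomb scaler_sumr; apply: eq_bigr => i _; rewrite mxE scalerA.
Qed.

(** The image of the coordinate unit sphere is compact and, by freeness,
avoids 0, so a ball of some radius m around 0 misses it; homogeneity extends
the bound m to all coordinate vectors. *)
Lemma lincomb_norm_lower n (b : 'I_n -> H) :
  (forall c, lincomb b c = 0 -> c = 0) ->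
  exists2 m : R, 0 < m & forall c, m * `|c| <= `|lincomb b c|.
Proof.
move=> b_free.
pose S : set 'rV[R]_n := [set c | `|c| = 1].
have Scpt : compact S.
  apply: bounded_closed_compact.
    by exists 1; split=> // M M1 c /= ->; exact: ltW.
  apply: (@preimage_closed _ _ (fun c : 'rV[R]_n => `|c|) [set x | x = 1]).
    by move=> ? _; exact: norm_continuous.
  exact: closed_eq.
have : closed (lincomb b @` S).
  apply: compact_closed; first exact: norm_hausdorff.
  by apply: continuous_compact Scpt;
    exact/continuous_subspaceT/lincomb_continuous.
rewrite -openC => S_open.
have nS : (~` (lincomb b @` S)) 0.
  move=> [c /= c1 /b_free c0]; move: c1; rewrite c0 /S /= normr0 => /esym/eqP.
  by rewrite oner_eq0.
have /nbhs_ballP[m /= m0 mS] := open_nbhs_nbhs (conj S_open nS).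
exists m => // c; have [->|c0] := eqVneq c 0.
  by rewrite normr0 mulr0.
rewrite leNgt; apply/negP => cm.
have nc0 : 0 < `|c| by rewrite normr_gt0.
apply: (mS (lincomb b (`|c|^-1 *: c))).
  rewrite -ball_normE /= sub0r normrN lincombZ normrZ ger0_norm ?invr_ge0//.
  by rewrite mulrC ltr_pdivrMr.
exists (`|c|^-1 *: c) => //; rewrite /S /=.
by rewrite normrZ ger0_norm ?invr_ge0// mulVf// gt_eqF.
Qed.

Lemma finite_dimensional_ball_compact (r : R) : finite_dimensional H ->
  compact [set x : H | `|x| <= r].
Proof.
move=> /free_spanning_family[n [b [b_span b_free]]].
have [m m0 mb] := lincomb_norm_lower b_free.
pose D : set 'rV[R]_n := [set c | `|c| <= r / m].
have Dcpt : compact D.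
  apply: bounded_closed_compact.
    by exists (r / m); split=> [|M M1 c /= /le_trans];
      [exact: num_real|apply; exact: ltW].
  apply: (@preimage_closed _ _ (fun c : 'rV[R]_n => `|c|) [set x | x <= r / m]).
    by move=> ? _; exact: norm_continuous.
  exact: closed_le.
apply: (@subclosed_compact _ _ (lincomb b @` D)).
- apply: (@preimage_closed _ _ (fun x : H => `|x|) [set x | x <= r]).
    by move=> ? _; exact: norm_continuous.
  exact: closed_le.
- by apply: continuous_compact Dcpt;
    exact/continuous_subspaceT/lincomb_continuous.
- move=> x /= xr; have [c xE] := b_span x; exists c => //=.
  by rewrite /D /= ler_pdivlMr// mulrC (le_trans (mb c))// -xE.
Qed.

End FiniteDimension.

(** * Minty sets of the split equilibrium problem *)

Section SplitMinty.
Context (R : realType) (H1 H2 : normedModType R).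
Variables (C : set H1) (Q : set H2) (A : {linear H1 -> H2}).
Variables (f : H1 -> H1 -> R) (g : H2 -> H2 -> R).

Definition split_minty_set (e : R) : set (H1 * H2) :=
  [set z | [/\ minty_set C f e z.1, minty_set Q g e z.2 & `|z.2 - A z.1| <= e]].

Lemma split_minty_set_le e e' : e <= e' ->
  split_minty_set e `<=` split_minty_set e'.
Proof.
move=> ee' z [Cz Qz zA]; split; try exact: minty_set_le ee' _ _.
exact: le_trans ee'.
Qed.

Lemma split_minty_set_closed e : bounded_operator A ->
  closed C -> closed Q -> lsc_snd C f -> lsc_snd Q g ->
  closed (split_minty_set e).
Proof.
move=> [M AM] Ccl Qcl flsc glsc.
have fst_cont : continuous (@fst H1 H2) by move=> z; exact: cvg_fst.
have snd_cont : continuous (@snd H1 H2) by move=> z; exact: cvg_snd.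
have A_cont : continuous A.
  apply/linear_bounded_continuous/bounded_funP => r.
  exists (`|M| * r) => x xr; apply: le_trans (AM x) _.
  by apply: le_trans (ler_norm _) _; rewrite normrM normr_id ler_wpM2l.
have -> : split_minty_set e = (fst @^-1` minty_set C f e) `&`
    (snd @^-1` minty_set Q g e) `&`
    ((fun z => `|z.2 - A z.1|) @^-1` [set x | x <= e]).
  by apply/seteqP; split=> [z [? ? ?]|z [[? ?] ?]].
apply: closedI; first apply: closedI.
- by apply: preimage_closed;
    [move=> ? _; exact: fst_cont|exact: minty_set_closed].
- by apply: preimage_closed;
    [move=> ? _; exact: snd_cont|exact: minty_set_closed].
- apply: preimage_closed; last exact: closed_le.
  move=> z _; apply: (@cvg_norm _ _ _ (nbhs z) _ (fun z => z.2 - A z.1)).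
  apply: cvgB; first exact: snd_cont.
  by apply: (continuous_comp (fst_cont z)); exact: A_cont.
Qed.

(** Since z.2 = A z.1, the defect y - A x is multiplied by t along the segment
from z to w. *)
Lemma split_minty_set_segment e z w (t : R) :
  convex_set C -> convex_set Q -> convex_snd C f -> convex_snd Q g ->
  split_minty_set 0 z -> split_minty_set e w -> 0 <= e -> 0 <= t <= 1 ->
  split_minty_set e (z + t *: (w - z)).
Proof.
move=> Ccvx Qcvx fcvx gcvx [Cz Qz zA] [Cw Qw wA] e0 t01.
split; try exact: minty_set_segment.
have {}zA : z.2 = A z.1 by apply/eqP; rewrite -subr_eq0 -normr_le0.
rewrite (_ : z + _ = (z.1 + t *: (w.1 - z.1), z.2 + t *: (w.2 - z.2)))//=.
have -> : z.2 + t *: (w.2 - z.2) - A (z.1 + t *: (w.1 - z.1)) =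
    t *: (w.2 - A w.1).
  rewrite (linearD A) linearZ (linearB A) -zA opprD addrACA subrr add0r.
  by rewrite -scalerBr opprB addrA subrK.
rewrite normrZ.
have /andP[t0 t1] := t01.
rewrite ger0_norm//; apply: le_trans wA.
by rewrite ler_piMl.
Qed.

Lemma split_minty z : convex_set C -> convex_set Q ->
  convex_snd C f -> convex_snd Q g ->
  hemicontinuous_bifun C f -> hemicontinuous_bifun Q g ->
  (forall p q, C p -> Q q -> 0 <= f p p /\ 0 <= g q q) ->
  split_minty_set 0 z -> SEP_solutions C Q A f g z.
Proof.
move=> Ccvx Qcvx fcvx gcvx fhemi ghemi diag [Cz Qz zA].
have {}zA : z.2 = A z.1 by apply/eqP; rewrite -subr_eq0 -normr_le0.
have [Cz1 _] := Cz; have [Qz2 _] := Qz.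
split=> //.
- by apply: minty Cz => // p Cp; have [] := diag p z.2 Cp Qz2.
- by apply: minty Qz => // q Qq; have [] := diag z.1 q Cz1 Qq.
Qed.

Lemma split_minty_set_bigcap z :
  (forall e, 0 < e -> split_minty_set e z) -> split_minty_set 0 z.
Proof.
move=> Nz.
have [[Cz _] [Qz _] _] := Nz 1 ltr01.
split; try split=> //.
- move=> p Cp; apply/ler_addgt0Pr => e /Nz[[_ fz] _ _].
  by rewrite add0r; exact: fz.
- move=> q Qq; apply/ler_addgt0Pr => e /Nz[_ [_ gz] _].
  by rewrite add0r; exact: gz.
- by apply/ler_addgt0Pr => e /Nz[_ _]; rewrite add0r.
Qed.

(** The only use of monotonicity: f p x <= - f x p moves the unknown to the
second argument. *)
Lemma monotone_split_minty_set e z : monotone_bifun C f -> monotone_bifun Q g ->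
  C z.1 -> Q z.2 -> `|z.2 - A z.1| <= e ->
  (forall p, C p -> - e <= f z.1 p) -> (forall q, Q q -> - e <= g z.2 q) ->
  split_minty_set e z.
Proof.
move=> fmono gmono Cz Qz zA fz gz; split=> //; split=> //.
- by move=> p Cp; move: (fmono _ _ Cz Cp) (fz _ Cp); lra.
- by move=> q Qq; move: (gmono _ _ Qz Qq) (gz _ Qq); lra.
Qed.

End SplitMinty.

(** The Hilbert norm and the maximum norm of a product define the same
convergence, so that the rest of the argument can be carried out with the
maximum norm. *)
Lemma cvg_hilbert_prod_cvg (R : realType) (H1 H2 : normedModType R)
    (z_ : nat -> H1 * H2) (z : H1 * H2) :
  z_ @ \oo --> z -> hilbert_prod_cvg z_ z.
Proof.
move=> zz.
have z1 : (fun n => `|(z_ n).1 - z.1|) @ \oo --> (0 : R).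
  rewrite -(@normr0 _ H1) -(subrr z.1); apply: cvg_norm.
  apply: cvgB; last exact: cvg_cst.
  by apply: cvg_comp zz _; exact: cvg_fst.
have z2 : (fun n => `|(z_ n).2 - z.2|) @ \oo --> (0 : R).
  rewrite -(@normr0 _ H2) -(subrr z.2); apply: cvg_norm.
  apply: cvgB; last exact: cvg_cst.
  by apply: cvg_comp zz _; exact: cvg_snd.
have z12 : (fun n => `|(z_ n - z).1| ^+ 2 + `|(z_ n - z).2| ^+ 2) @ \oo
    --> (0 : R).
  rewrite -(addr0 (0 : R)) -[X in X + _](mulr0 (0 : R)).
  by rewrite -[X in _ + X](mulr0 (0 : R)); apply: cvgD; apply: cvgM.
rewrite /hilbert_prod_cvg /hilbert_prod_norm -sqrtr0.
by apply: cvg_comp z12 _; exact: sqrt_continuous.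
Qed.

(** * Shrinking of the Minty sets and well-posedness *)

Section FiniteDimensionalSEP.
Context (R : realType) (H1 H2 : normedModType R).
Hypotheses (fdimH1 : finite_dimensional H1) (fdimH2 : finite_dimensional H2).

Lemma finite_dimensional_sphere_compact (z : H1 * H2) (d : R) :
  compact [set w | `|w - z| = d].
Proof.
apply: (@subclosed_compact _ _
  ([set x : H1 | `|x| <= d + `|z|] `*` [set y : H2 | `|y| <= d + `|z|])).
- apply: (@preimage_closed _ _ (fun w : H1 * H2 => `|w - z|)
    [set x : R | x = d]); last exact: closed_eq.
  move=> w _; apply: (@cvg_norm _ _ _ (nbhs w) _ (fun w : H1 * H2 => w - z)).
  by apply: cvgB; [exact: cvg_id|exact: cvg_cst].
- by apply: compact_setX; exact: finite_dimensional_ball_compact.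
- move=> w /= wz.
  have : `|w| <= d + `|z| by rewrite -wz -{1}(subrK z w) ler_normD.
  by rewrite {1}/Num.norm /= ge_max => /andP.
Qed.

Variables (C : set H1) (Q : set H2) (A : {linear H1 -> H2}).
Variables (f : H1 -> H1 -> R) (g : H2 -> H2 -> R).
Hypotheses (C_closed : closed C) (C_convex : convex_set C).
Hypotheses (Q_closed : closed Q) (Q_convex : convex_set Q).
Hypothesis A_bounded : bounded_operator A.
Hypotheses (f_hemi : hemicontinuous_bifun C f)
  (g_hemi : hemicontinuous_bifun Q g).
Hypotheses (f_convex : convex_snd C f) (g_convex : convex_snd Q g).
Hypotheses (f_lsc : lsc_snd C f) (g_lsc : lsc_snd Q g).
Hypothesis fg_diag : forall p q, C p -> Q q -> 0 <= f p p /\ 0 <= g q q.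

(** Compactness of the sphere of radius d yields an N e that misses it;
star-shapedness about z then confines N e to the open ball. *)
Lemma split_minty_set_shrink z (d : R) :
  split_minty_set C Q A f g 0 z ->
  (forall w, SEP_solutions C Q A f g w -> w = z) -> 0 < d ->
  exists2 e : R, 0 < e &
    forall w, split_minty_set C Q A f g e w -> `|w - z| < d.
Proof.
move=> Nz z_uniq d0; apply: contrapT => no_e.
set N := split_minty_set C Q A f g.
pose S : set (H1 * H2) := [set w | `|w - z| = d].
have NS e : 0 < e -> N e `&` S !=set0.
  move=> e0; apply: contrapT => NS0; apply: no_e; exists e => // w Nw.
  rewrite ltNge; apply/negP => dw; apply: NS0.
  have w0 : 0 < `|w - z| by exact: lt_le_trans dw.
  (* the point of the sphere on the segment from z to w *)
  exists (z + (d / `|w - z|) *: (w - z)); split.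
    apply: split_minty_set_segment => //; first exact: ltW.
    by rewrite divr_ge0 ?(ltW d0)//= ler_pdivrMr// mul1r.
  rewrite /S /= addrC addKr normrZ ger0_norm ?divr_ge0 ?(ltW d0)//.
  by rewrite divfK// gt_eqF.
pose F := filter_from [set e : R | 0 < e] (fun e => N e `&` S).
have FF : ProperFilter F.
  apply: filter_from_proper; last by move=> e /NS.
  apply: filter_from_filter; first by exists 1; exact: ltr01.
  move=> e e' e0 e'0; exists (Num.min e e'); first by rewrite /= lt_min e0.
  move=> w [Nw Sw]; split; split=> //; apply: split_minty_set_le Nw.
    by rewrite ge_min lexx.
  by rewrite ge_min lexx orbT.
have FS : F S by exists 1; [exact: ltr01|exact: subIsetr].
have [w [Sw]] := @finite_dimensional_sphere_compact z d F FF FS.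
rewrite clusterE => wF.
have Nw e : 0 < e -> N e w.
  move=> e0; apply: split_minty_set_closed => //.
  by apply: wF; exists e => //; exact: subIsetl.
have wz : w = z.
  by apply/z_uniq/split_minty => //; exact: split_minty_set_bigcap.
by move: Sw; rewrite /= wz subrr normr0 => d_eq0; rewrite -d_eq0 ltxx in d0.
Qed.

End FiniteDimensionalSEP.

Theorem theorem4p1 (R : realType) (H1 H2 : completeNormedModType R)
    (hilbertH1 : is_hilbert H1) (hilbertH2 : is_hilbert H2)
    (fdimH1 : finite_dimensional H1) (fdimH2 : finite_dimensional H2)
    (C : set H1) (Q : set H2)
    (C_neq0 : C !=set0) (C_closed : closed C) (C_convex : convex_set C)
    (Q_neq0 : Q !=set0) (Q_closed : closed Q) (Q_convex : convex_set Q)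
    (A : {linear H1 -> H2}) (A_bounded : bounded_operator A)
    (f : H1 -> H1 -> R) (g : H2 -> H2 -> R)
    (f_hemi : hemicontinuous_bifun C f) (g_hemi : hemicontinuous_bifun Q g)
    (f_mono : monotone_bifun C f) (g_mono : monotone_bifun Q g)
    (f_convex : convex_snd C f) (g_convex : convex_snd Q g)
    (f_lsc : lsc_snd C f) (g_lsc : lsc_snd Q g)
    (fg_diag : forall p q, C p -> Q q -> 0 <= f p p /\ 0 <= g q q) :
  SEP_well_posed C Q A f g <-> exists! z, SEP_solutions C Q A f g z.
Proof.
split=> [[z [Sz _]]|[z [Sz z_uniq]]].
  by exists z; rewrite Sz; split=> // w ->.
exists z; split.
  by apply/seteqP; split=> [w /z_uniq|w ->].
move=> z_ [eps [eps_gt0 eps0 z_eps]]; apply: cvg_hilbert_prod_cvg.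
have Nz : split_minty_set C Q A f g 0 z.
  case: Sz => Cz Qz zA fz gz; apply: monotone_split_minty_set => //.
  - by rewrite zA subrr normr0.
  - by move=> p /fz; rewrite oppr0.
  - by move=> q /gz; rewrite oppr0.
apply/cvgrPdist_lt => d d0.
have [|e e0 Ne] := split_minty_set_shrink fdimH1 fdimH2 C_closed C_convex
  Q_closed Q_convex A_bounded f_hemi g_hemi f_convex g_convex f_lsc g_lsc
  fg_diag Nz _ d0; first by move=> w /z_uniq.
have eps_lt : \forall n \near \oo, eps n < e by exact: (cvgr_lt _ eps0).
near=> n; have epsn : eps n <= e by apply: ltW; near: n.
rewrite distrC; apply/Ne/(split_minty_set_le epsn).
by have [? ? ? ? ?] := z_eps n; exact: monotone_split_minty_set.
Unshelve. all: by end_near. Qed.
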